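(* Fix an integer $r \ge 3$ and positive integers $s_1, \ldots, s_{r-1}, t$. Then, as $n \to \infty$, $$z_r(n, K(s_1, \ldots, s_{r-1}, t)) > n^{1-o(1)} \cdot z_{r-1}(n, K(s_1, \ldots, s_{r-3}, s_{r-2}s_{r-1}, t)).$$
   Context: A $k$-graph is a $k$-uniform hypergraph. For positive integers $a_1,\ldots,a_k$, $K(a_1,\ldots,a_k)$ denotes the complete $k$-partite $k$-graph with parts of size $a_1,\ldots,a_k$: its vertex set is a disjoint union of sets $S_1,\ldots,S_k$ with $|S_i|=a_i$, and its edges are all sets $\{x_1,\ldots,x_k\}$ with $(x_1,\ldots,x_k)\in S_1\times\cdots\times S_k$. The Zarankiewicz number $z_k(n,K(a_1,\ldots,a_k))$ is the maximum number of edges in a $k$-partite $k$-graph $H$ with parts $X_1,\ldots,X_k$, each of size $n$, such that there is no copy of $K(a_1,\ldots,a_k)$ in $H$ with $S_i\subset X_i$ for all $1\le i\le k$ (copies of $K(a_1,\ldots,a_k)$ in $H$ with $S_i\not\subset X_i$ for some $i$ are allowed). When $r=3$, the hypergraph on the right-hand side is the complete bipartite graph $K(s_1s_2,t)$. The term $o(1)$ denotes a quantity tending to $0$ as $n\to\infty$ with $r, s_1,\ldots,s_{r-1},t$ fixed.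
   Formalization: The case s_1 = ... = s_{r-1} = t = 1 is excluded: there both Zarankiewicz numbers are 0, so the strict inequality would read 0 > 0 and fails for every n. *)

(* Defs.v *)
From mathcomp Require Import all_boot.

Set Implicit Arguments.
Unset Strict Implicit.
Unset Printing Implicit Defensive.

(* The vertex (i, x) is the x-th vertex of the part X_i; the k parts are
   disjoint copies of 'I_n. *)
Definition vertex (k n : nat) : finType := ('I_k * 'I_n)%type.

Definition part (k n : nat) (i : 'I_k) : {set vertex k n} :=
  [set v : vertex k n | v.1 == i].

Definition kgraph (k n : nat) (H : {set {set vertex k n}}) : bool :=
  [forall e in H, #|e| == k].

Definition kpartite (k n : nat) (H : {set {set vertex k n}}) : bool :=
  [forall e in H, forall i : 'I_k, #|e :&: part n i| == 1%N].

Definition complete_kpartite (k n : nat) (S : {ffun 'I_k -> {set vertex k n}}) :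
    {set {set vertex k n}} :=
  [set [set x i | i : 'I_k]
    | x : {ffun 'I_k -> vertex k n} & [forall i, x i \in S i]].

(* Only copies with S_i inside X_i, in this order, count. The sizes
   a_1, ..., a_k are the entries of a, numbered from 0. *)
Definition has_aligned_copy (k n : nat) (a : seq nat)
    (H : {set {set vertex k n}}) : bool :=
  [exists S : {ffun 'I_k -> {set vertex k n}},
    [forall i : 'I_k, (S i \subset part n i) && (#|S i| == nth 0%N a i)]
    && (complete_kpartite S \subset H)].

(* z_k(n, K(a_1, ..., a_k)), for a of size k *)
Definition zarankiewicz (k n : nat) (a : seq nat) : nat :=
  \max_(H : {set {set vertex k n}}
         | [&& kgraph H, kpartite H & ~~ has_aligned_copy a H]) #|H|.

(* (s_1, ..., s_{r-3}, s_{r-2} s_{r-1}) for s = (s_1, ..., s_{r-1}) *)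
Definition merge_last_two (s : seq nat) : seq nat :=
  let m := (size s - 2)%N in
  rcons (take m s) (nth 0%N s m * nth 0%N s m.+1)%N.

(* Main.v *)
(* Let A be a subset of Z/n without three-term progressions. The bipartite
   graph {(x, y) : y - x \in A} splits into the n matchings
   M_v = {(v - 2a, v - a) : a \in A}, each of size |A|, and each induced because
   a cross edge would give the progression a', a, 2a - a' in A. In an extremal
   (r-1)-partite hypergraph, replace the vertex v of the part of index r-2 by
   the edges of M_v. This multiplies the number of edges by |A|, and the
   s_{r-2} s_{r-1} edges of a complete bipartite subgraph belong to distinct
   matchings, so a forbidden copy comes from a forbidden copy before the
   replacement. Behrend's spheres, in each fixed dimension d, give
   |A| >= c_d n^(1 - 2/d). *)
Require Import Defs.
From mathcomp Require Import all_boot all_order all_algebra.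
From mathcomp Require Import all_classical all_reals all_analysis.
From mathcomp Require Import zify ring lra.

Set Implicit Arguments.
Unset Strict Implicit.
Unset Printing Implicit Defensive.

Import Order.TTheory GRing.Theory Num.Theory numFieldNormedType.Exports.

(** * Uniqueness of digits in a fixed base *)

Lemma sum_digits_lt B d (u : 'I_d -> nat) :
  (forall i, u i < B) -> \sum_(i < d) u i * B ^ i < B ^ d.
Proof.
elim: d u => [|d IHd] u uB; first by rewrite big_ord0.
rewrite big_ord_recr /= expnS.
have := IHd (fun i => u (widen_ord (leqnSn d) i)) (fun i => uB _).
have := leq_mul (uB ord_max) (leqnn (B ^ d)); rewrite /=.
set x := \sum_(i < d) _; lia.
Qed.

(** The lowest digit is the residue modulo [B], and the quotient carries the remaining digits. *)
Lemma sum_digits_inj B d (u v : 'I_d -> nat) :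
    (forall i, u i < B) -> (forall i, v i < B) ->
  \sum_(i < d) u i * B ^ i = \sum_(i < d) v i * B ^ i -> u =1 v.
Proof.
elim: d u v => [|d IHd] u v uB vB; first by move=> _ [].
have B0 : 0 < B := leq_ltn_trans (leq0n _) (uB ord0).
have shift (w : 'I_d.+1 -> nat) : \sum_(i < d.+1) w i * B ^ i
    = (\sum_(i < d) w (lift ord0 i) * B ^ i) * B + w ord0.
  rewrite big_ord_recl muln1 addnC big_distrl; congr addn.
  by apply: eq_bigr => i _; rewrite /= expnSr mulnA.
rewrite !shift => eq_uv i.
have eq0 : u ord0 = v ord0.
  by have := congr1 (modn^~ B) eq_uv; rewrite /= !modnMDl !modn_small.
case: (unliftP ord0 i) => [j|] -> //.
apply: (IHd (u \o lift ord0) (v \o lift ord0)) => // [k|k|] //=.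
  by move/eqP: eq_uv; rewrite eq0 eqn_add2r eqn_pmul2r // => /eqP.
Qed.

(** * Progression-free sets in cyclic groups *)

Local Open Scope ring_scope.

(** Addition is modulo [n.+1]. The case [x = y] also excludes two elements that differ by half of an
    even modulus. *)
Definition ap_free n (A : {set 'I_n.+1}) :=
  [forall x in A, forall y in A, forall z in A,
    (x + y == z + z) ==> (x == z)].

Lemma ap_freeP n (A : {set 'I_n.+1}) :
  reflect {in A & &, forall x y z, x + y = z + z -> x = z} (ap_free A).
Proof.
apply: (iffP 'forall_in_'forall_in_'forall_in_implyP) => apA.
  by move=> x y z xA yA zA /eqP/(apA x xA y yA z zA)/eqP.
by move=> x xA y yA z zA /eqP eq_xyz; apply/eqP/(apA x y).
Qed.

Definition max_ap_free n := (\max_(A : {set 'I_n.+1} | ap_free A) #|A|)%N.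

Local Close Scope ring_scope.

(** * Behrend's construction *)

Section Behrend.
Variables (d m n : nat).
Hypothesis fit_n : 2 * (2 * m) ^ d <= n.+1.
Implicit Types f g h : {ffun 'I_d -> 'I_m}.

Definition encode f := \sum_(i < d) f i * (2 * m) ^ i.
Definition sqnorm f := \sum_(i < d) f i ^ 2.

(** The factor 2 keeps a sum of two codes below [n.+1], so an equation between such sums modulo
    [n.+1] holds over the integers. *)
Lemma encode_lt f : 2 * encode f < n.+1.
Proof.
apply: leq_trans fit_n; rewrite ltn_pmul2l //; apply: sum_digits_lt => i.
by have := ltn_ord (f i); lia.
Qed.

Lemma encode_inj : injective encode.
Proof.
move=> f g /sum_digits_inj eq_fg; apply/ffunP => i; apply: val_inj.
by apply: eq_fg => j; [have := ltn_ord (f j) | have := ltn_ord (g j)]; lia.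
Qed.

(* Spheres are strictly convex: a midpoint on the sphere of its endpoints is
   an endpoint. Doubling the base avoids carries in the sum. *)
Lemma encode_midpoint f g h :
    sqnorm f = sqnorm h -> sqnorm g = sqnorm h ->
  encode f + encode g = encode h + encode h -> f = h.
Proof.
move=> eq_fh eq_gh; rewrite /encode -!big_split /=.
under eq_bigr do rewrite -mulnDl.
under [RHS]eq_bigr do rewrite -mulnDl.
move=> /(@sum_digits_inj _ _ (fun i => f i + g i) (fun i => h i + h i)) mid.
have {}mid i : f i + g i = h i + h i.
  apply: mid => j; first by have := ltn_ord (f j); have := ltn_ord (g j); lia.
  by have := ltn_ord (h j); lia.
(* One of the truncated differences vanishes, so this is the absolute difference. As [h] is the
   midpoint, the parallelogram identity holds coordinatewise. *)
pose dist i := (f i - h i) + (h i - f i).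
have : sqnorm f + sqnorm g = 2 * sqnorm h + 2 * \sum_i dist i ^ 2.
  rewrite /sqnorm !big_distrr -!big_split; apply: eq_bigr => i _ /=.
  by have := mid i; rewrite /dist; case: (leqP (f i) (h i)) => ?; nia.
have [-> ->] : sqnorm f = sqnorm h /\ sqnorm g = sqnorm h by [].
move=> dist0; have {dist0} /eqP : \sum_i dist i ^ 2 = 0 by lia.
rewrite sum_nat_eq0 => /forallP dist0; apply/ffunP => i; apply: val_inj => /=.
by have := dist0 i; rewrite /dist expn_eq0 /=; lia.
Qed.

Lemma sphere_card k : #|[set f | sqnorm f == k]| <= max_ap_free n.
Proof.
have encode_ord f : encode f < n.+1 by have := encode_lt f; lia.
pose enc f := Ordinal (encode_ord f).
have enc_inj : injective enc by move=> f g [/encode_inj].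
rewrite -(card_imset _ enc_inj); apply: leq_bigmax_cond.
apply/ap_freeP => _ _ _ /imsetP[f + ->] /imsetP[g + ->] /imsetP[h + ->].
rewrite !inE => /eqP fk /eqP gk /eqP hk /(congr1 val) /=.
have := encode_lt f; have := encode_lt g; have := encode_lt h => lth ltg ltf.
rewrite !modn_small; [|lia|lia] => eq_sum.
by rewrite (@encode_midpoint f g h) ?fk ?gk ?hk.
Qed.

(** Pigeonhole: the [m ^ d] points lie on at most [d * m ^ 2] spheres, and each sphere encodes to a
    progression-free set. *)
Lemma behrend : 0 < d -> 0 < m -> m ^ d <= d * m ^ 2 * max_ap_free n.
Proof.
move=> d0 m0.
have sqnorm_lt f : sqnorm f < d * m ^ 2.
  apply: (@leq_ltn_trans (\sum_(i < d) m.-1 ^ 2)).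
    by apply: leq_sum => i _; rewrite leq_sqr; have := ltn_ord (f i); lia.
  by rewrite sum_nat_const card_ord; nia.
have -> : m ^ d = \sum_(f : {ffun 'I_d -> 'I_m}) 1.
  by rewrite sum1_card card_ffun !card_ord.
rewrite (partition_big (fun f => Ordinal (sqnorm_lt f)) xpredT) //=.
have -> : d * m ^ 2 * max_ap_free n = \sum_(k < d * m ^ 2) max_ap_free n.
  by rewrite sum_nat_const card_ord.
apply: leq_sum => k _.
rewrite sum1_card; apply: leq_trans (sphere_card k).
by apply: subset_leq_card; apply/fintype.subsetP => f; rewrite !inE => /eqP <-.
Qed.

End Behrend.

(** * Partite hypergraphs as sets of functions *)

Section Transversals.
Variables (k n : nat).
Implicit Types (f g : {ffun 'I_k -> 'I_n}) (F : {set {ffun 'I_k -> 'I_n}}).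
Implicit Types (a : seq nat) (H : {set {set vertex k n}}).

(** A set that meets each part exactly once is the graph of a function, so a set [F] of functions
    stands for a partite hypergraph. *)
Definition edge f : {set vertex k n} := [set (i, f i) | i : 'I_k].

Lemma mem_edge f i x : ((i, x) \in edge f) = (x == f i).
Proof.
apply/imsetP/eqP => [[j _ [-> ->]] //|->]; first by exists i.
Qed.

Lemma edge_inj : injective edge.
Proof.
move=> f g eq_fg; apply/ffunP => i.
by apply/eqP; rewrite -mem_edge -eq_fg mem_edge.
Qed.

Lemma card_edge f : #|edge f| = k.
Proof. by rewrite card_imset ?card_ord // => i j []. Qed.

Lemma edge_part f i : edge f :&: part n i = [set (i, f i)].
Proof.
apply/setP => -[j x]; rewrite !inE mem_edge /= xpair_eqE andbC.
by case: (j =P i) => // ->.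
Qed.

Lemma transversal_edge (e : {set vertex k n}) :
  (forall i, #|e :&: part n i| == 1) -> exists f, e = edge f.
Proof.
move=> e1.
have ex i : exists x, e :&: part n i == [set (i, x)].
  have /cards1P[[j x] eq_e] := e1 i; exists x; rewrite eq_e.
  have : (j, x) \in e :&: part n i by rewrite eq_e set11.
  by rewrite !inE => /andP[_ /= /eqP->].
exists [ffun i => xchoose (ex i)]; apply/setP => -[i x]; rewrite mem_edge ffunE.
have /eqP/setP/(_ (i, x)) := xchooseP (ex i).
by rewrite !inE /= eqxx andbT xpair_eqE eqxx.
Qed.

Lemma kpartite_edges F : kgraph (edge @: F) && kpartite (edge @: F).
Proof.
apply/andP; split; apply/forall_inP => _ /imsetP[f _ ->].
  by rewrite card_edge.
by apply/forallP => i; rewrite edge_part cards1.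
Qed.

Lemma kpartiteE H : kpartite H -> exists F, H = edge @: F.
Proof.
move=> /forall_inP Hpart; exists (edge @^-1: H); apply/setP => e.
apply/idP/imsetP => [eH|[f + ->]]; last by rewrite inE.
by have /forallP/transversal_edge[f e_f] := Hpart _ eH; exists f; rewrite ?inE -?e_f.
Qed.

Definition contains_box a F :=
  exists T : 'I_k -> {set 'I_n},
    (forall i, #|T i| = nth 0 a i) /\
    (forall f, (forall i, f i \in T i) -> f \in F).

(** Every vertex of [S i] has first coordinate [i], so [S i] amounts to its projection to ['I_n],
    and the edges of the copy form the product of these projections. *)
Lemma aligned_copyP a F :
  has_aligned_copy a (edge @: F) <-> contains_box a F.
Proof.
split=> [/existsP[S /andP[/forallP sS /fintype.subsetP copyS]] | [T [cardT boxT]]].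
  have Spart i : S i = [set (i, x) | x in [set v.2 | v in S i]].
    have /andP[/fintype.subsetP Si _] := sS i.
    rewrite -imset_comp -[LHS]imset_id; apply: eq_in_imset => -[j x] /Si.
    by rewrite inE /= => /eqP ->.
  exists (fun i => [set v.2 | v in S i]); split=> [i|f fT].
    have /andP[_ /eqP <-] := sS i.
    by rewrite [in RHS]Spart [in RHS]card_imset // => x y [].
  rewrite -(mem_imset _ _ edge_inj); apply: copyS; apply/imsetP.
  exists [ffun i => (i, f i)]; last by apply: eq_imset => i; rewrite ffunE.
  rewrite inE; apply/forallP => i; rewrite ffunE Spart.
  by apply: imset_f; apply: fT.
apply/existsP; exists [ffun i => [set (i, x) | x in T i]]; apply/andP; split.
  apply/forallP => i; rewrite ffunE card_imset ?cardT ?eqxx ?andbT;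
    last by move=> x y [].
  by apply/fintype.subsetP => _ /imsetP[x _ ->]; rewrite inE.
apply/fintype.subsetP => _ /imsetP[x + ->]; rewrite inE => /forallP xT.
have {}xT i : x i = (i, (x i).2) /\ (x i).2 \in T i.
  by have := xT i; rewrite ffunE => /imsetP[y yT ->].
have -> : [set x i | i : 'I_k] = edge [ffun i => (x i).2].
  by apply: eq_imset => i; rewrite ffunE -(xT i).1.
by apply: imset_f; apply: boxT => i; rewrite ffunE; have [] := xT i.
Qed.

Lemma zarankiewicz_ge a F : ~ contains_box a F -> #|F| <= zarankiewicz k n a.
Proof.
move=> noF; rewrite -(card_imset _ edge_inj); apply: leq_bigmax_cond.
rewrite andbA kpartite_edges; apply/negP.
by rewrite aligned_copyP.
Qed.

(** An empty maximum defaults to 0, so positivity provides an admissible hypergraph and hence an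
    extremal one. *)
Lemma zarankiewicz_attained a : 0 < zarankiewicz k n a ->
  exists2 F, ~ contains_box a F & #|F| = zarankiewicz k n a.
Proof.
rewrite /zarankiewicz => z_gt0.
have [|H /and3P[_ /kpartiteE[F eqH] noH] ->] := eq_bigmax_cond (fun H => #|H|)
    (A := [pred H | [&& @kgraph k n H, kpartite H & ~~ has_aligned_copy a H]]).
  apply: contraLR z_gt0; rewrite -eqn0Ngt -leqNgt => /eqP/card0_eq P0.
  by rewrite big_pred0.
exists F; last by rewrite eqH card_imset //; exact: edge_inj.
by rewrite -aligned_copyP -eqH; apply/negP.
Qed.

Lemma box_nonempty a (T : 'I_k -> {set 'I_n}) :
    size a = k -> all (leq 1) a -> (forall i, #|T i| = nth 0 a i) ->
  exists f, forall i, f i \in T i.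
Proof.
move=> sz_a a_gt0 cardT.
have ex i : exists x, x \in T i.
  apply/set0Pn; rewrite -card_gt0 cardT.
  by apply: (allP a_gt0); rewrite mem_nth ?sz_a.
by exists [ffun i => xchoose (ex i)] => i; rewrite ffunE; apply: xchooseP.
Qed.

(** A single edge contains no box that has a side of size at least 2 and no empty side. *)
Lemma zarankiewicz_gt0 a : size a = k -> 0 < n ->
  all (leq 1) a -> has (leq 2) a -> 0 < zarankiewicz k n a.
Proof.
move=> sz_a n_gt0 a_gt0 /hasP[x /(nthP 0)[i ltik <-] ai_gt1].
pose f0 : {ffun 'I_k -> 'I_n} := [ffun=> Ordinal n_gt0].
rewrite -(cards1 f0); apply: zarankiewicz_ge => -[T [cardT boxT]].
have [f fT] := box_nonempty sz_a a_gt0 cardT.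
rewrite sz_a in ltik; pose i' := Ordinal ltik.
suff : #|T i'| <= #|[set Ordinal n_gt0]| by rewrite cards1 cardT leqNgt ai_gt1.
apply/subset_leq_card/fintype.subsetP => y yT; rewrite inE.
have /boxT : forall j, [ffun j => if j == i' then y else f j] j \in T j.
  by move=> j; rewrite ffunE; case: eqP => // ->.
by rewrite inE => /eqP/ffunP/(_ i'); rewrite !ffunE eqxx => ->.
Qed.

End Transversals.

(** * The blow-up along induced matchings *)

Section Blowup.
Variables (q n : nat).
Local Notation pt := 'I_n.+1.
Implicit Types (f : {ffun 'I_q.+2 -> pt}) (g : {ffun 'I_q.+3 -> pt}).

Local Open Scope ring_scope.

(** The coordinates [q] and [q.+1], with values [x] and [y], merge into [y + (y - x)], the index [v]
    of the matching [M_v] through [(x, y)]. *)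
Definition collapse g : {ffun 'I_q.+2 -> pt} :=
  [ffun i : 'I_q.+2 => if (i < q)%N then g (inord i)
   else if i == q :> nat then g (inord q.+1) + (g (inord q.+1) - g (inord q))
   else g (inord q.+2)].

Definition expand (a : pt) f : {ffun 'I_q.+3 -> pt} :=
  [ffun i : 'I_q.+3 => if (i < q)%N then f (inord i)
   else if i == q :> nat then f (inord q) - a - a
   else if i == q.+1 :> nat then f (inord q) - a
   else f (inord q.+1)].

Lemma expand_diff a f :
  expand a f (inord q.+1) - expand a f (inord q) = a.
Proof.
rewrite !ffunE ![nat_of_ord (inord _)]inordK; try lia.
by rewrite ltnn eqxx ltnNge leqnSn gtn_eqF // eqxx /= opprB addrCA subrr addr0.
Qed.

Lemma expandK a f : collapse (expand a f) = f.
Proof.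
apply/ffunP => i; have ltiq2 := ltn_ord i; rewrite ffunE expand_diff.
case: ltngtP => [ltiq|ltqi|eq_iq]; rewrite ffunE.
- rewrite ![nat_of_ord (inord _)]inordK; try lia.
  by rewrite ltiq inord_val.
- rewrite ![nat_of_ord (inord _)]inordK; try lia.
  rewrite ltnNge ltnW //= !gtn_eqF //; congr (f _); apply: val_inj => /=.
  by rewrite inordK //; lia.
- rewrite ![nat_of_ord (inord _)]inordK; try lia.
  rewrite ltnNge leqnSn /= gtn_eqF // eqxx subrK; congr (f _).
  by apply: val_inj; rewrite /= inordK.
Qed.

(** The blow-up of an extremal [F] consists of all [expand a f] with [a] in [A] and [f] in [F]. A
    box in it collapses to a box in [F], whose merged side has the product size because [mid] is
    injective. *)
Lemma zarankiewicz_blowup (A : {set pt}) (s : seq nat) t :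
    ap_free A -> size s = q.+2 -> all (leq 1) s -> (0 < t)%N ->
  (#|A| * zarankiewicz q.+2 n.+1 (rcons (merge_last_two s) t)
     <= zarankiewicz q.+3 n.+1 (rcons s t))%N.
Proof.
move=> /ap_freeP apA sz_s s_gt0 t_gt0.
have [->|z_gt0] := posnP (zarankiewicz q.+2 n.+1 (rcons (merge_last_two s) t)).
  by rewrite muln0.
have [F noF <-] := zarankiewicz_attained z_gt0.
pose phi (p : pt * {ffun 'I_q.+2 -> pt}) := expand p.1 p.2.
have phi_inj : injective phi.
  move=> [a f] [b g] eq_ab; congr (_, _).
    by rewrite -(expand_diff a f) -(expand_diff b g) [expand a f]eq_ab.
  by rewrite -(expandK a f) -(expandK b g) [expand a f]eq_ab.
rewrite -cardsX -(card_imset _ phi_inj); apply: zarankiewicz_ge.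
move=> [T [cardT boxT]]; apply: noF.
have {}boxT g : (forall i, g i \in T i) ->
    (g (inord q.+1) - g (inord q) \in A) && (collapse g \in F).
  by move=> /boxT/imsetP[[a f] + ->]; rewrite inE expand_diff expandK.
(* Positive sizes give one edge of the box. Varying its coordinates [q] and [q.+1] puts every
   difference [y - x] in [A]. *)
have [g0 g0T] : exists g, forall i, g i \in T i.
  apply: box_nonempty cardT; first by rewrite size_rcons sz_s.
  by rewrite all_rcons t_gt0.
pose x0 : 'I_q.+3 := inord q; pose y0 : 'I_q.+3 := inord q.+1.
have y0x0 : (y0 == x0) = false.
  by rewrite -val_eqE /= ![nat_of_ord (inord _)]inordK; lia.
have TA x y : x \in T x0 -> y \in T y0 -> y - x \in A.
  move=> xT yT; pose g : {ffun 'I_q.+3 -> pt} :=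
    [ffun i => if i == x0 then x else if i == y0 then y else g0 i].
  have /boxT/andP[+ _] : forall i, g i \in T i.
    move=> i; rewrite ffunE; case: eqVneq => [->|_] //.
    by case: eqVneq => [->|_].
  by rewrite !ffunE y0x0 !eqxx.
pose mid (p : pt * pt) := p.2 + (p.2 - p.1).
(* the matchings [M_v] are induced, so edges of a complete
   bipartite subgraph have distinct [v] *)
have mid_inj : {in finset.setX (T x0) (T y0) &, injective mid}.
  move=> [x y] [x' y'] /setXP[/= xT yT] /setXP[/= xT' yT'].
  rewrite /mid /= => eq_mid.
  have eq_d : y' - x' = y - x.
    (* The cross pair [(x, y')] yields the progression [y' - x'], [y - x], [y' - x] in [A]. *)
    apply: (apA _ (y' - x)); rewrite ?TA //.
    by rewrite addrA [_ + y']addrC -eq_mid addrAC.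
  move: eq_mid; rewrite eq_d => /addIr eq_y.
  by congr (_, _) => //; move: eq_d; rewrite eq_y => /addrI/oppr_inj.
pose T' (i : 'I_q.+2) := if (i < q)%N then T (inord i)
  else if i == q :> nat then mid @: finset.setX (T x0) (T y0) else T (inord q.+2).
exists T'; split=> [i|f fT'].
  have m_eq : (size s - 2 = q)%N by rewrite sz_s subn2.
  have sz_take : size (take q s) = q by rewrite size_takel ?sz_s //; lia.
  have ltiq2 := ltn_ord i.
  rewrite /merge_last_two m_eq /T' !nth_rcons size_rcons sz_take.
  case: (ltngtP i q) => [ltiq|ltqi|->].
  - rewrite cardT !nth_rcons sz_s ![nat_of_ord (inord _)]inordK; try lia.
    by rewrite ltiq2 ltnS (ltnW ltiq) nth_take.
  - rewrite cardT nth_rcons sz_s ![nat_of_ord (inord _)]inordK; try lia.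
    have -> : i = q.+1 :> nat by lia.
    by rewrite !ltnn !eqxx.
  - rewrite card_in_imset // cardsX !cardT !nth_rcons sz_s.
    rewrite ![nat_of_ord (inord _)]inordK; try lia.
    by rewrite !ltnS leqnn leqnSn.
have := fT' (inord q); rewrite /T' inordK; last by lia.
rewrite ltnn eqxx => /imsetP[[x y] /setXP[/= xT yT] fq].
(* Since [f] takes the value [mid (x, y)] at [q], expanding by [y - x] restores [x] and [y] and
   lifts [f] into the box [T]. *)
suff /boxT/andP[_] : forall i, expand (y - x) f i \in T i by rewrite expandK.
move=> i; have ltiq3 := ltn_ord i; rewrite ffunE.
case: (ltngtP i q) => [ltiq|ltqi|eq_iq].
- have := fT' (inord i); rewrite /T' inordK; last by lia.
  by rewrite ltiq inord_val.
- case: eqP => [eq_iq1|ne_iq1].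
    rewrite fq /mid /= addrK; congr (_ \in T _): yT.
    by apply: val_inj; rewrite /= inordK.
  have := fT' (inord q.+1); rewrite /T' inordK; last by lia.
  rewrite ltnNge leqnSn gtn_eqF //=; congr (_ \in T _).
  by apply: val_inj; rewrite /= inordK //; lia.
- rewrite fq /mid /= addrK subKr; congr (_ \in T _): xT.
  by apply: val_inj; rewrite /= inordK //; lia.
Qed.

End Blowup.

(** * Asymptotics of the largest progression-free set *)

Local Open Scope classical_set_scope.
Local Open Scope ring_scope.

Lemma max_ap_free_attained n :
  exists2 A : {set 'I_n.+1}, ap_free A & #|A| = max_ap_free n.
Proof.
have ap0 : ap_free (finset.set0 : {set 'I_n.+1}).
  by apply/ap_freeP => x y z; rewrite inE.
have [|A apA eqA] := @eq_bigmax_cond _ [pred A : {set 'I_n.+1} | ap_free A]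
    (fun A => #|A|).
  by apply/card_gt0P; exists finset.set0.
by exists A.
Qed.

Lemma max_ap_free_le n : (max_ap_free n <= n.+1)%N.
Proof.
by apply/bigmax_leqP => A _; rewrite -[X in (_ <= X)%N]card_ord max_card.
Qed.

Section Asymptotics.
Variable R : realType.

(** This is [behrend] in logarithmic form for the largest [m] that fits. The terms [ln 2] and
    [d%:R * ln 4] come from rounding [m], and [ln d%:R] from the number of spheres. *)
Lemma ln_max_ap_free_ge d n : (2 <= d)%N -> (2 * 2 ^ d <= n.+1)%N ->
  (1 - 2 / d%:R) * (ln n.+1%:R - ln 2 - d%:R * ln 4) - ln d%:R
    <= ln (max_ap_free n)%:R :> R.
Proof.
move=> d2 n_ge.
pose P m := (2 * (2 * m) ^ d <= n.+1)%N.
have P1 : exists m, P m by exists 1%N; rewrite /P muln1.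
have Pub m : P m -> (m <= n.+1)%N.
  apply: leq_trans; apply: (@leq_trans (m ^ d)).
    by case: m => // m; rewrite -[X in (X <= _)%N]expn1 leq_pexp2l // ltnW.
  by rewrite expnMn mulnA leq_pmull // muln_gt0 expn_gt0.
case: (ex_maxnP P1 Pub) => m Pm mmax.
have m0 : (0 < m)%N by apply: mmax; rewrite /P muln1.
(* By maximality [m.+1] does not fit, and [2 * m.+1 <= 4 * m]. *)
have n_lt : (n.+1 <= 2 * (4 * m) ^ d)%N.
  have : ~~ P m.+1 by apply/negP => /mmax; rewrite ltnn.
  rewrite /P -ltnNge => /ltnW/leq_trans; apply.
  by rewrite leq_pmul2l // leq_exp2r; lia.
have := behrend Pm (ltnW d2) m0.
set M := max_ap_free n => leM.
have M0 : (0 < M)%N.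
  by move: leM; case: M => //; rewrite muln0 leqn0 expn_eq0; lia.
have d0 : (0 : R) < d%:R by rewrite ltr0n ltnW.
have m0R : (0 : R) < m%:R by rewrite ltr0n.
have M0R : (0 : R) < M%:R by rewrite ltr0n.
have lnN : ln n.+1%:R <= ln 2 + d%:R * (ln 4 + ln m%:R) :> R.
  have x0 : (0 : R) < 4 * m%:R by rewrite mulr_gt0.
  rewrite -[ln 4 + _]lnM ?posrE // mulr_natl -lnXn //.
  rewrite -lnM ?posrE ?exprn_gt0 // ler_ln ?posrE //.
    by rewrite -!natrM -natrX -natrM ler_nat.
  by rewrite mulr_gt0 // exprn_gt0.
have lnM' : d%:R * ln m%:R <= ln d%:R + 2 * ln m%:R + ln M%:R :> R.
  have x0 : (0 : R) < d%:R * m%:R ^+ 2 by rewrite mulr_gt0 // exprn_gt0.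
  rewrite !mulr_natl -!lnXn // -lnM ?posrE ?exprn_gt0 // -lnM ?posrE //.
  rewrite ler_ln ?posrE ?exprn_gt0 //; last exact: mulr_gt0.
  by rewrite -!natrX -!natrM ler_nat.
have c0 : 0 <= 1 - 2 / d%:R :> R.
  by rewrite subr_ge0 ler_pdivrMr // mul1r ler_nat.
have : (1 - 2 / d%:R) * (ln n.+1%:R - ln 2 - d%:R * ln 4)
    <= (1 - 2 / d%:R) * (d%:R * ln m%:R) :> R.
  by apply: ler_wpM2l => //; lra.
have -> : (1 - 2 / d%:R) * (d%:R * ln m%:R) = (d%:R - 2) * ln m%:R :> R.
  by field; rewrite gt_eqF.
lra.
Qed.

(* The factor 1/2 makes the final inequality strict. *)
Definition deficit n : R := 1 - ln ((max_ap_free n.-1)%:R / 2) / ln n%:R.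

(** The deficit is defined to solve this equation. The predecessor appears because
    [max_ap_free n.-1] concerns the integers modulo [n]. *)
Lemma powR_deficit n : (2 <= n)%N -> (0 < max_ap_free n.-1)%N ->
  n%:R `^ (1 - deficit n) = (max_ap_free n.-1)%:R / 2.
Proof.
move=> n2 M0; have lnn : ln n%:R != 0 :> R by rewrite gt_eqF // ln_gt0 // ltr1n.
rewrite /deficit subKr /powR pnatr_eq0; case: eqP => [|_]; first by lia.
by rewrite divfK // lnK // posrE divr_gt0 // ltr0n.
Qed.

Lemma deficit_ge0 n : (2 <= n)%N -> (0 < max_ap_free n.-1)%N -> 0 <= deficit n.
Proof.
move=> n2 M0; have lnn : 0 < ln n%:R :> R by rewrite ln_gt0 // ltr1n.
rewrite subr_ge0 ler_pdivrMr // mul1r ler_ln ?posrE ?divr_gt0 ?ltr0n //; last by lia.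
rewrite ler_pdivrMr // -natrM ler_nat; have := max_ap_free_le n.-1; lia.
Qed.

Lemma max_ap_free_gt0 n : (0 < max_ap_free n)%N.
Proof.
apply: leq_trans (leq_bigmax_cond [set ord0]%SET _); first by rewrite cards1.
by apply/ap_freeP => x y z; rewrite !inE => /eqP-> _ /eqP->.
Qed.

(** For fixed [d] and large [n] the deficit is at most [2 / d + C / ln n]; first [d] is taken large,
    then [n]. *)
Lemma deficit_cvg0 : deficit n @[n --> \oo] --> (0 : R).
Proof.
apply/cvgrPdist_lt => e e0.
(* The shift by 2 ensures both [4 / e < d] and [2 <= d]. *)
pose d := (Num.truncn (4 / e)).+2.
have d_gt : 2 / d%:R < e / 2.
  have : 4 / e < d%:R.
    by apply: lt_trans (truncnS_gt _) _; rewrite ltr_nat.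
  have d0 : 0 < d%:R :> R by rewrite ltr0n.
  by rewrite ltr_pdivrMr // ltr_pdivrMr //; lra.
(* One [ln 2] comes from the halving in [deficit], the other terms from [ln_max_ap_free_ge]. *)
pose C : R := ln 2 + ln 2 + d%:R * ln 4 + ln d%:R.
near=> n.
have n_ge : (2 * 2 ^ d <= n)%N by near: n; exact: nbhs_infty_ge.
have n2 : (2 <= n)%N.
  by apply: leq_trans n_ge; rewrite -[X in (X <= _)%N]muln1 leq_pmul2l // expn_gt0.
have lnn : 0 < ln n%:R :> R by rewrite ln_gt0 // ltr1n.
have C_lt : C < e / 2 * ln n%:R.
  rewrite mulrC -ltr_pdivrMr; last by lra.
  rewrite -ltr_expR lnK ?posrE ?ltr0n; last by lia.
  by near: n; exact: nbhs_infty_gtr.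
have M0 := max_ap_free_gt0 n.-1.
rewrite sub0r normrN ger0_norm ?deficit_ge0 //.
have := @ln_max_ap_free_ge d n.-1 isT.
rewrite prednK; last by lia.
move=> /(_ n_ge) lnM_ge.
rewrite /deficit ltrBlDl -ltrBlDr ltr_pdivlMr // ln_div ?posrE ?ltr0n //.
have d0 : 0 < d%:R :> R by rewrite ltr0n.
have c0 : 0 <= 2 / d%:R :> R by rewrite divr_ge0 // ltW.
have := ler_wpM2r (ltW lnn) (ltW d_gt).
have ln2 : 0 <= ln 2 :> R by rewrite ln_ge0 // ler1n.
have ln4 : 0 <= ln 4 :> R by rewrite ln_ge0 // ler1n.
have := mulr_ge0 c0 ln2.
have := mulr_ge0 c0 (mulr_ge0 (ltW d0) ln4).
move: lnM_ge C_lt; rewrite /C; nra.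
Unshelve. all: by end_near.
Qed.

End Asymptotics.

(** One [eps] serves all [r], [s] and [t]. If every size were 1, both Zarankiewicz numbers would be
    0 and the strict inequality would fail, hence [hnontriv]. *)
Theorem theorem1 (R : realType) (r : nat) (hr : (3 <= r)%N)
    (s : (r.-1).-tuple nat) (t : nat)
    (hs : forall i : 'I_r.-1, (0 < tnth s i)%N) (ht : (0 < t)%N)
    (hnontriv : has (fun a => 1 < a)%N (rcons s t)) :
  exists eps : nat -> R,
    eps n @[n --> \oo] --> (0 : R) /\
    \forall n \near \oo,
      (n%:R : R) `^ (1 - eps n)
        * (zarankiewicz r.-1 n (rcons (merge_last_two s) t))%:R
      < (zarankiewicz r n (rcons s t))%:R.
Proof.
exists (@deficit R); split; first exact: deficit_cvg0.
case: r hr s hs hnontriv => [|[|[|q]]] //= _ s hs hnontriv.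
near=> n.
have n2 : (2 <= n)%N by near: n; exact: nbhs_infty_ge.
have s_gt0 : all (leq 1) s by apply/all_tnthP.
have z0 : (0 < zarankiewicz q.+3 n (rcons s t))%N.
  apply: zarankiewicz_gt0 => //; first by rewrite size_rcons size_tuple.
    by lia.
  by rewrite all_rcons ht.
rewrite powR_deficit // ?max_ap_free_gt0 //.
have [A apA cardA] := max_ap_free_attained n.-1.
have := zarankiewicz_blowup apA (size_tuple s) s_gt0 ht.
rewrite cardA prednK; last by lia.
rewrite -(ler_nat R) natrM.
set z := (zarankiewicz _ _ (rcons (merge_last_two s) t)).
(* The left side is half of [max_ap_free n.-1] times [z], so at most half of the right side, which
   is positive. *)
have : (0 : R) < (zarankiewicz q.+3 n (rcons s t))%:R by rewrite ltr0n.
have : (0 : R) <= (max_ap_free n.-1)%:R * z%:R by rewrite -natrM ler0n.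
lra.
Unshelve. all: by end_near.
Qed.
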